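(* Let $m$ be an odd positive integer, $\ell=5m$, and let $(\mathbf a,\mathbf b)$ be a Legendre pair of length $\ell$ with $\sum_{i}a_i=\sum_{i}b_i=1$. Let $n_1,n_2\ge 0$ and $x$ be the integers with $n_1+n_2=2\ell+2$ such that, for $r=1,2,3,4$, $$\mathrm{PSD}_{\mathbf a}(rm)=n_1+(-1)^{\lfloor r/2\rfloor}\sqrt5\,x,\qquad \mathrm{PSD}_{\mathbf b}(rm)=n_2-(-1)^{\lfloor r/2\rfloor}\sqrt5\,x.$$ Then there exist non-negative integers $k_1,k_2$ such that $n_i=10k_i+6$ for $i=1,2$, $k_1+k_2=m-1$, and $2k_i+2\equiv x\pmod 4$ for $i=1,2$.
   Context: For $\mathbf a\in\mathbb{R}^\ell$ indexed by $\mathbb{Z}_\ell$: $\mathrm{PAF}_{\mathbf a}(j)=\sum_{i=0}^{\ell-1}a_i a_{i-j}$ (indices mod $\ell$), $\mathrm{DFT}_{\mathbf a}(j)=\sum_{r=0}^{\ell-1}e^{2\pi i jr/\ell}a_r$, and $\mathrm{PSD}_{\mathbf a}(j)=|\mathrm{DFT}_{\mathbf a}(j)|^2$. A pair $(\mathbf a,\mathbf b)$ of vectors in $\{-1,1\}^\ell$ is a Legendre pair of length $\ell$ if $\mathrm{PAF}_{\mathbf a}(j)+\mathrm{PAF}_{\mathbf b}(j)=-2$ for all $j\in\mathbb{Z}_\ell\setminus\{0\}$ and $\sum_i a_i=\sum_i b_i$. Integers $n_1,n_2,x$ as in the claim exist for every such Legendre pair, and are unique since $\sqrt5$ is irrational.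 *)

(* Defs.v *)
From HB Require Import structures.
From mathcomp Require Import all_boot all_order all_algebra.
From mathcomp Require Export complex.
From mathcomp Require Import reals trigo.

Set Implicit Arguments.
Unset Strict Implicit.
Unset Printing Implicit Defensive.

Import Order.TTheory GRing.Theory Num.Theory.
Local Open Scope ring_scope.
Local Open Scope complex_scope.

(* A vector of length l indexed by Z/lZ is a function 'Z_l -> R, so that index
   arithmetic is modulo l.  Since 'Z_l is Z/lZ only for 1 < l, everything below
   is meant for 1 < l. *)

Definition PAF (R : realType) (l : nat) (a : 'Z_l -> R) (j : 'Z_l) : R :=
  \sum_(i : 'Z_l) a i * a (i - j).

(* e^(i t), given by Euler's formula. *)
Definition expi (R : realType) (t : R) : R[i] := cos t +i* sin t.

(* j and r are read as their representatives in {0, ..., l - 1}. *)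
Definition DFT (R : realType) (l : nat) (a : 'Z_l -> R) (j : 'Z_l) : R[i] :=
  \sum_(r : 'Z_l)
    expi (2 * pi * (nat_of_ord j)%:R * (nat_of_ord r)%:R / l%:R) * (a r)%:C.

Definition PSD (R : realType) (l : nat) (a : 'Z_l -> R) (j : 'Z_l) : R :=
  Normc.normc (DFT a j) ^+ 2.

Definition pm1_vector (R : realType) (l : nat) (a : 'Z_l -> R) : Prop :=
  forall i, a i = 1 \/ a i = -1.

Definition Legendre_pair (R : realType) (l : nat) (a b : 'Z_l -> R) : Prop :=
  [/\ pm1_vector a, pm1_vector b,
      forall j : 'Z_l, j <> 0 -> PAF a j + PAF b j = -2
    & \sum_(i : 'Z_l) a i = \sum_(i : 'Z_l) b i].

(* Main.v *)
(* The values DFT_a(rm) are the discrete Fourier transform of length 5 of the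
   folded vector A_s = sum of a_i over i = s mod 5.  Each A_s is a sum of m odd
   terms, hence odd.  Writing P_j for the periodic autocorrelations of A and using
   2 cos(2 pi / 5) = (sqrt 5 - 1) / 2, one gets n = P_0 - (P_1 + P_2) / 2 and
   x = (P_1 - P_2) / 2 by adding and subtracting the cases r = 1 and r = 2.  Since
   P_0 + 2 P_1 + 2 P_2 = (sum A_s)^2 = 1, this is 4 n = 5 P_0 - 1 and
   4 x = 4 P_1 + P_0 - 1.  Finally P_0 = 8 k + 5, as odd squares are 1 mod 8, and
   P_1 = 4 sum u_s u_(s-1) + 4 sum u_s + 5 = 1 mod 4 when A_s = 2 u_s + 1. *)
Require Import Defs.
From mathcomp Require Import all_boot all_order all_algebra.
From mathcomp Require Import reals trigo.
From mathcomp Require Import zify ring lra.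

Import Order.TTheory GRing.Theory Num.Theory.
Local Open Scope ring_scope.
Local Open Scope complex_scope.

Lemma sum_Zp_nat (V : nmodType) (l : nat) (G : 'Z_l -> V) :
  (1 < l)%N -> \sum_(i : 'Z_l) G i = \sum_(0 <= k < l) G k%:R.
Proof.
case: l G => [|[|l]] // G _.
by rewrite big_mkord; apply: eq_bigr => i _; rewrite natr_Zp.
Qed.

Lemma sum_nat_mul5 (V : nmodType) (F : nat -> V) (m : nat) :
  \sum_(0 <= i < 5 * m) F i =
  \sum_(s < 5) \sum_(0 <= q < m) F (5 * q + s)%N.
Proof.
elim: m => [|m IH].
  by rewrite muln0 big_geq // big1 // => s _; rewrite big_geq.
rewrite mulnSr (@big_cat_nat _ _ _ (5 * m)) ?leq_addr //= IH.
under [RHS]eq_bigr => s _ do rewrite big_nat_recr //=.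
rewrite big_split /= -[in X in _ + X = _](add0n (5 * m)%N) big_addn addKn.
by rewrite big_mkord; under [in X in _ + X = _]eq_bigr do rewrite addnC.
Qed.

Lemma expiD2npi (R : realType) (t : R) (n : nat) :
  expi (t + 2 * pi * n%:R) = expi t.
Proof.
rewrite mulr_natr [2 * pi]mulrC mulr_natr.
by rewrite /expi (periodicn (@cosD2pi R)) (periodicn (@sinD2pi R)).
Qed.

Lemma cos_2pi5 (R : realType) : cos (2 * pi / 5 : R) = (Num.sqrt 5 - 1) / 4.
Proof.
set t := 2 * pi / 5; set c := cos t.
have pi0 := pi_gt0 R.
have c_gt0 : 0 < c by apply: cos_gt0_pihalf; rewrite /t; apply/andP; split; lra.
have s_gt0 : 0 < sin t by apply: sin_gt0_pi; rewrite /t; apply/andP; split; lra.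
have cs : sin t ^+ 2 = 1 - c ^+ 2 by rewrite /c -(cos2Dsin2 t); ring.
have c2 : cos (t + t) = 2 * c ^+ 2 - 1 by rewrite cosD -/c; ring: cs.
(* [3 t] and [2 t] are opposite modulo [2 pi] *)
have c32 : cos (t + t + t) = cos (t + t).
  by rewrite -[RHS]cosN -(cosD2pi (- _)); congr cos; rewrite /t; lra.
have : (c - 1) * (4 * c ^+ 2 + 2 * c - 1) = 0.
  have cs3 : c * sin t ^+ 2 = c * (1 - c ^+ 2) by rewrite cs.
  by move: c32; rewrite cosD c2 sinD -/c => c32; lra.
(* The root [c = 1] would force [sin t = 0]. Of the two roots of the quadratic factor, [c > 0] keeps
   the one with [4 * c + 1 = sqrt 5]. *)
move/eqP; rewrite mulf_eq0 => /orP [/eqP c1|/eqP c_root]; first nra.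
have s5 : Num.sqrt (5 : R) ^+ 2 = 5 by rewrite sqr_sqrtr ?ler0n.
have s5_ge0 : 0 <= Num.sqrt (5 : R) by exact: sqrtr_ge0.
nra.
Qed.

(** For [k = 5 * q + s], the angle [2 pi r m k / (5 m)] is [2 pi r s / 5] plus [r * q] full turns,
    so the exponential depends on [s] only. *)
Lemma DFT_mul5 (R : realType) (m : nat) (a : 'Z_(5 * m) -> R) (r : nat) :
  (0 < m)%N -> (r < 5)%N ->
  DFT a (r * m)%:R =
  \sum_(s < 5) expi (2 * pi * r%:R / 5 * s%:R) *
               (\sum_(0 <= q < m) a (5 * q + s)%:R)%:C.
Proof.
move=> m_gt0 r_lt5; have l_gt1 : (1 < 5 * m)%N by lia.
have m_neq0 : m%:R != 0 :> R by rewrite pnatr_eq0 -lt0n.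
rewrite /DFT sum_Zp_nat // (eq_big_nat _ _ (F2 := fun k =>
  expi (2 * pi * (r * m)%:R * k%:R / (5 * m)%:R) * (a k%:R)%:C)); last first.
  (* [r < 5] makes [r * m] its own representative modulo [5 * m]. *)
  by move=> k /andP [_ k_lt]; rewrite !val_Zp_nat // !modn_small // ltn_pmul2r.
rewrite sum_nat_mul5; apply: eq_bigr => s _.
rewrite rmorph_sum mulr_sumr; apply: eq_bigr => q _; congr (_ * _).
rewrite -(expiD2npi _ (2 * pi * r%:R / 5 * s%:R) (r * q)); congr expi.
rewrite (natrM _ r m) (natrM _ r q) (natrM _ 5 m) natrD (natrM _ 5 q).
by field; rewrite m_neq0.
Qed.

(** The squared modulus is [P_0 + 2 cos t P_1 + 2 cos (2 t) P_2], and the quadratic equation for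
    [cos t] gives [2 cos (2 t) = - (1 + 2 cos t)]. *)
Lemma normc_expi5 (R : realType) (k : nat) (A : nat -> R) :
  let t := 2 * pi * k%:R / 5 in
  4 * cos t ^+ 2 + 2 * cos t - 1 = 0 ->
  Normc.normc (\sum_(s < 5) expi (t * s%:R) * (A s)%:C) ^+ 2 =
  A 0 ^+ 2 + A 1 ^+ 2 + A 2 ^+ 2 + A 3 ^+ 2 + A 4 ^+ 2
  + 2 * cos t * (A 0 * A 1 + A 1 * A 2 + A 2 * A 3 + A 3 * A 4 + A 4 * A 0)
  - (1 + 2 * cos t)
    * (A 0 * A 2 + A 1 * A 3 + A 2 * A 4 + A 3 * A 0 + A 4 * A 1).
Proof.
move=> t c_root; rewrite !big_ord_recl big_ord0 /=.
(* As [5 t = 2 pi k], the angles [4 t] and [3 t] reduce to [- t] and [- 2 t]. *)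
have e4 : expi (t * 4) = expi (- t).
  by rewrite -[RHS](expiD2npi _ _ k); congr expi; rewrite /t; field.
have e3 : expi (t * 3) = expi (- (t + t)).
  by rewrite -[RHS](expiD2npi _ _ k); congr expi; rewrite /t; field.
have e2 : expi (t * 2) = expi (t + t) by congr expi; ring.
case: e4 e3 e2 => c4 s4 [c3 s3] [c2 s2].
rewrite /Normc.normc /= sqr_sqrtr; last by rewrite addr_ge0 ?sqr_ge0.
rewrite /bump /= !add1n c4 s4 c3 s3 c2 s2 !mulr0 !mulr1 cos0 sin0.
rewrite !cosN !sinN cosD sinD.
have cos_sq : cos t ^+ 2 = (1 - 2 * cos t) / 4 by lra.
have sin_sq : sin t ^+ 2 = (3 + 2 * cos t) / 4.
  by have := cos2Dsin2 t; lra.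
move: cos_sq sin_sq.
(* Doubling the cosine and sine clears denominators: [field] can then rewrite with monic equations
   for [d ^+ 2] and [e ^+ 2]. *)
have [d ->] : exists d, cos t = d / 2 by exists (2 * cos t); field.
have [e ->] : exists e, sin t = e / 2 by exists (2 * sin t); field.
move=> d_sq e_sq.
have {}d_sq : d ^+ 2 = 1 - d by lra.
have {}e_sq : e ^+ 2 = 3 + d by lra.
by field: d_sq e_sq.
Qed.

Lemma odd_fold_sum (R : realType) (m : nat) (a : 'Z_(5 * m) -> R) (s : nat) :
  odd m -> pm1_vector a ->
  exists u : int, \sum_(0 <= q < m) a (5 * q + s)%:R = (2 * u + 1)%:~R.
Proof.
move=> m_odd a_pm1.
(* The induction runs over all lengths [k]: a sum of [k] signs has the parity of [k]. *)
have sum_parity k : exists u : int,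
    \sum_(0 <= q < k) a (5 * q + s)%:R = (2 * u + k%:Z)%:~R.
  elim: k => [|k [u IH]]; first by exists 0; rewrite big_geq.
  rewrite big_nat_recr //= IH; case: (a_pm1 (5 * k + s)%:R) => ->.
    by exists u; rewrite -[1]/(1%:~R) -intrD; congr intmul; lia.
  by exists (u - 1); rewrite -[-1]/((-1)%:~R) -intrD; congr intmul; lia.
by have [u ->] := sum_parity m; exists (u + m./2%:Z); congr intmul; lia.
Qed.

Lemma odd_fold_arith (u0 u1 u2 u3 u4 n x P0 P1 P2 : int) :
  let A0 := 2 * u0 + 1 in let A1 := 2 * u1 + 1 in let A2 := 2 * u2 + 1 in
  let A3 := 2 * u3 + 1 in let A4 := 2 * u4 + 1 in
  A0 + A1 + A2 + A3 + A4 = 1 ->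
  P0 = A0 ^+ 2 + A1 ^+ 2 + A2 ^+ 2 + A3 ^+ 2 + A4 ^+ 2 ->
  P1 = A0 * A1 + A1 * A2 + A2 * A3 + A3 * A4 + A4 * A0 ->
  P2 = A0 * A2 + A1 * A3 + A2 * A4 + A3 * A0 + A4 * A1 ->
  2 * n = 2 * P0 - (P1 + P2) -> 2 * x = P1 - P2 ->
  exists k z : int, [/\ 0 <= k, n = 10 * k + 6 & x = 2 * k + 2 + 4 * z].
Proof.
move=> A0 A1 A2 A3 A4 sumA P0E P1E P2E nE xE.
(* Here [w = v (v + 1) / 2], so [(2 v + 1) ^+ 2 = 8 w + 1]. Five such squares give [P0 = 8 k + 5]
   with [k >= 0]. *)
have half v : exists2 w : int, 0 <= w & v ^+ 2 = 2 * w - v.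
  have vv1_ge0 : 0 <= v * (v + 1).
    by have [v_ge0|v_lt0] := leP 0 v; [apply: mulr_ge0|apply: mulr_le0]; lia.
  have [w vE] : exists w : int, v * (v + 1) = 2 * w.
    have [w [->|->]] : exists w : int, v = 2 * w \/ v = 2 * w + 1.
      by exists (v %/ 2)%Z; lia.
      by exists (w * (2 * w + 1)); ring.
    by exists ((2 * w + 1) * (w + 1)); ring.
  by exists w; [lia|rewrite -vE; ring].
have [w0 w0_ge0 w0E] := half u0; have [w1 w1_ge0 w1E] := half u1.
have [w2 w2_ge0 w2E] := half u2; have [w3 w3_ge0 w3E] := half u3.
have [w4 w4_ge0 w4E] := half u4.
pose k := w0 + w1 + w2 + w3 + w4.
have P0k : P0 = 8 * k + 5.
  by rewrite P0E /A0 /A1 /A2 /A3 /A4 /k; lra.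
have P012 : P0 + 2 * P1 + 2 * P2 = 1.
  have -> : P0 + 2 * P1 + 2 * P2 = (A0 + A1 + A2 + A3 + A4) ^+ 2.
    by rewrite P0E P1E P2E; ring.
  by rewrite sumA.
pose z := u0 * u1 + u1 * u2 + u2 * u3 + u3 * u4 + u4 * u0
          + (u0 + u1 + u2 + u3 + u4).
have P1z : P1 = 4 * z + 5 by rewrite P1E /A0 /A1 /A2 /A3 /A4 /z; ring.
(* From [4 x = 4 P1 + P0 - 1 = 16 z + 8 k + 24], hence the shift to [z + 1]. *)
by exists k, (z + 1); split; rewrite ?addr_ge0 //; lra.
Qed.

(** Stated for a single vector, so that it serves [a] with [x] and [b] with [- x]. *)
Lemma PSD_mul5_arith (R : realType) (m : nat) (a : 'Z_(5 * m) -> R) (n x : int) :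
  odd m -> pm1_vector a -> \sum_i a i = 1 ->
  PSD a m%:R = n%:~R + Num.sqrt 5 * x%:~R ->
  PSD a (2 * m)%:R = n%:~R - Num.sqrt 5 * x%:~R ->
  exists k z : int, [/\ 0 <= k, n = 10 * k + 6 & x = 2 * k + 2 + 4 * z].
Proof.
move=> m_odd a_pm1 sum_a PSD1 PSD2.
have m_gt0 : (0 < m)%N by case: m m_odd {a a_pm1 sum_a PSD1 PSD2}.
pose A s := \sum_(0 <= q < m) a (5 * q + s)%:R.
have s5 : Num.sqrt (5 : R) ^+ 2 = 5 by rewrite sqr_sqrtr ?ler0n.
have s5_neq0 : Num.sqrt (5 : R) != 0 by rewrite sqrtr_eq0 -ltNge ltr0n.
have cos1 := cos_2pi5 R.
have cos2 : cos (2 * pi * 2 / 5 : R) = (- Num.sqrt 5 - 1) / 4.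
  have -> : 2 * pi * 2 / 5 = 2 * pi / 5 *+ 2 :> R by rewrite -[RHS]mulr_natr; field.
  by rewrite cos_mulr2n cos1; field: s5.
move: PSD1; rewrite -[X in PSD a X%:R]mul1n /PSD DFT_mul5 //.
rewrite (normc_expi5 R 1 A) mulr1 cos1; last by field: s5.
move=> PSD1.
move: PSD2; rewrite /PSD DFT_mul5 //.
rewrite (normc_expi5 R 2 A) cos2; last by field: s5.
move=> PSD2.
have sumA : A 0 + A 1 + A 2 + A 3 + A 4 = 1.
  rewrite -sum_a sum_Zp_nat; last by lia.
  by rewrite sum_nat_mul5 !big_ord_recl big_ord0 /= !addrA addr0.
have A_odd s : exists u : int, A s = (2 * u + 1)%:~R by exact: odd_fold_sum.
have [u0 A0E] := A_odd 0; have [u1 A1E] := A_odd 1; have [u2 A2E] := A_odd 2.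
have [u3 A3E] := A_odd 3; have [u4 A4E] := A_odd 4.
have intr_injR (i j : int) : i%:~R = j%:~R :> R -> i = j by exact: intr_inj.
rewrite A0E A1E A2E A3E A4E in sumA PSD1 PSD2.
apply: (odd_fold_arith u0 u1 u2 u3 u4) => //; apply: intr_injR.
- by lra.
- by lra.
(* [PSD1 - PSD2] reads [2 sqrt 5 x = sqrt 5 (P_1 - P_2)]; the previous goal is their sum, where
   [sqrt 5] cancels. *)
- by apply: (mulfI s5_neq0); lra.
Qed.

Theorem corollary6 (R : realType) (m : nat) (hm : (0 < m)%N) (hodd : odd m)
    (a b : 'Z_(5 * m) -> R) (hab : Legendre_pair a b)
    (ha : \sum_(i : 'Z_(5 * m)) a i = 1) (hb : \sum_(i : 'Z_(5 * m)) b i = 1)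
    (n1 n2 x : int) (hn1 : 0 <= n1) (hn2 : 0 <= n2)
    (hn : n1 + n2 = 2 * (5 * m)%N%:Z + 2)
    (hPSDa : forall r : nat, (1 <= r <= 4)%N ->
       PSD a (r * m)%N%:R = n1%:~R + (-1) ^+ (r %/ 2)%N * Num.sqrt 5 * x%:~R)
    (hPSDb : forall r : nat, (1 <= r <= 4)%N ->
       PSD b (r * m)%N%:R = n2%:~R - (-1) ^+ (r %/ 2)%N * Num.sqrt 5 * x%:~R) :
  exists k1 k2 : int,
    [/\ 0 <= k1 /\ 0 <= k2,
        n1 = 10 * k1 + 6 /\ n2 = 10 * k2 + 6,
        k1 + k2 = m%:Z - 1
      & (2 * k1 + 2 = x %[mod 4])%Z /\ (2 * k2 + 2 = x %[mod 4])%Z].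
Proof.
case: hab => a_pm1 b_pm1 _ _.
have [k1 [z1 [k1_ge0 n1E x1E]]] : exists k z : int,
    [/\ 0 <= k, n1 = 10 * k + 6 & x = 2 * k + 2 + 4 * z].
  apply: (PSD_mul5_arith R m a) => //.
    by rewrite -[X in PSD a X%:R]mul1n hPSDa // expr0 mul1r.
  by rewrite hPSDa // expr1 mulN1r mulNr.
(* This yields [2 k2 + 2] congruent to [- x] modulo 4, which is also [x] because [x] is even by
   [x1E]. *)
have [k2 [z2 [k2_ge0 n2E x2E]]] : exists k z : int,
    [/\ 0 <= k, n2 = 10 * k + 6 & - x = 2 * k + 2 + 4 * z].
  apply: (PSD_mul5_arith R m b) => //; rewrite intrN mulrN.
    by rewrite -[X in PSD b X%:R]mul1n hPSDb // expr0 mul1r.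
  by rewrite hPSDb // expr1 mulN1r mulNr.
by exists k1, k2; split; [split|split| |split]; lia.
Qed.
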